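(* Let $m\ge 0$ be an integer and let $\{\beta_{2\lambda}\}_{\lambda=-2m}^{2m+1}$ be the real mask of a $(4m+2)$-point binary subdivision scheme. Let $f=(f_i)_{i\in\mathbb{Z}}$ be a real sequence and let $h=(h_i)_{i\in\mathbb{Z}}$ be the sequence obtained by applying the $(4m+2)$-point binary scheme twice to $f$. Then for all $\varphi\in\mathbb{Z}$ $$h_{4\varphi-2}=\sum_{\lambda=-m}^{m}\sum_{\alpha=-2m}^{2m+1}\beta_{2-4\lambda}\beta_{2\alpha}\,f_{\varphi+\alpha+\lambda-1}+\sum_{\lambda=-m}^{m}\sum_{\alpha=-2m}^{2m+1}\beta_{-4\lambda}\beta_{2-2\alpha}\,f_{\varphi+\alpha+\lambda},$$ $$h_{4\varphi-1}=\sum_{\lambda=-m}^{m}\sum_{\alpha=-2m}^{2m+1}\beta_{4\lambda}\beta_{2\alpha}\,f_{\varphi+\alpha+\lambda-1}+\sum_{\lambda=-m}^{m}\sum_{\alpha=-2m}^{2m+1}\beta_{2+4\lambda}\beta_{2-2\alpha}\,f_{\varphi+\alpha+\lambda},$$ $$h_{4\varphi}=\sum_{\lambda=-m}^{m}\sum_{\alpha=-2m}^{2m+1}\beta_{2-4\lambda}\beta_{2-2\alpha}\,f_{\varphi+\alpha+\lambda}+\sum_{\lambda=-m}^{m}\sum_{\alpha=-2m}^{2m+1}\beta_{-4\lambda}\beta_{2\alpha}\,f_{\varphi+\alpha+\lambda},$$ $$h_{4\varphi+1}=\sum_{\lambda=-m}^{m}\sum_{\alpha=-2m}^{2m+1}\beta_{4\lambda}\beta_{2-2\alpha}\,f_{\varphi+\alpha+\lambda}+\sum_{\lambda=-m}^{m}\sum_{\alpha=-2m}^{2m+1}\beta_{2+4\lambda}\beta_{2\alpha}\,f_{\varphi+\alpha+\lambda}.$$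 Consequently these four equations, read as a map $f=g^{k}\mapsto h=g^{k+1}$, are the four subdivision rules of a $(6m+2)$-point relaxed quaternary subdivision scheme, whose coefficients of the control points are non-linear combinations (sums of products of two mask elements) of the coefficients of the $(4m+2)$-point binary subdivision scheme.
   Context: The $(4m+2)$-point binary subdivision scheme with mask $\{\beta_{2\lambda}\}_{\lambda=-2m}^{2m+1}$ maps a sequence $(g_i)_{i\in\mathbb{Z}}$ to the sequence $(G_i)_{i\in\mathbb{Z}}$ given for all $\varphi\in\mathbb{Z}$ by $$G_{2\varphi-1}=\sum_{\lambda=-2m}^{2m+1}\beta_{2\lambda}\,g_{\varphi+\lambda-1},\qquad G_{2\varphi}=\sum_{\lambda=-2m}^{2m+1}\beta_{2-2\lambda}\,g_{\varphi+\lambda}.$$ A quaternary subdivision scheme is a linear map on sequences $(g^k_i)\mapsto(g^{k+1}_i)$ given by four rules, one for each of $g^{k+1}_{4\varphi-2},g^{k+1}_{4\varphi-1},g^{k+1}_{4\varphi},g^{k+1}_{4\varphi+1}$, each a finite linear combination of the $g^k_{\varphi+j}$ with coefficients independent of $\varphi$ and $k$. It is called here ''$(6m+2)$-point relaxed'' when the rules for $g^{k+1}_{4\varphi},g^{k+1}_{4\varphi+1}$ use the $6m+2$ control points $g^k_{\varphi-3m},\dots,g^k_{\varphi+3m+1}$ and the rules for $g^{k+1}_{4\varphi-2},g^{k+1}_{4\varphi-1}$ use the $6m+3$ control points $g^k_{\varphi-3m-1},\dots,g^k_{\varphi+3m+1}$. *)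

(* Defs.v *)
From mathcomp Require Import all_boot all_order all_algebra.
From mathcomp Require Import functions reals zify.

Set Implicit Arguments.
Unset Strict Implicit.
Unset Printing Implicit Defensive.

Import Order.TTheory GRing.Theory Num.Theory.
Local Open Scope ring_scope.

(* The integers a, a + 1, ..., b in increasing order; empty when b < a. *)
Definition zrange (a b : int) : seq int :=
  [seq a + k%:Z | k <- iota 0 (if a <= b then `|(b - a)%R|%N.+1 else 0%N)].

Lemma mem_zrange (a b i : int) : (i \in zrange a b) = (a <= i <= b).
Proof.
apply/mapP/idP => [[k]|/andP[ai ib]].
  by rewrite mem_iota; case: ifP => ? ? ->; lia.
exists `|(i - a)%R|%N; last by lia.
by rewrite mem_iota; case: ifP => ?; lia.
Qed.

Lemma zrange_uniq (a b : int) : uniq (zrange a b).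
Proof. by rewrite map_inj_uniq ?iota_uniq// => x y; lia. Qed.

(* R^o rather than R, so that sequences carry the pointwise lmodType
   structure over R. *)
Definition zseq (R : realType) := int -> R^o.

(* A mask is given by a function beta on int, of which only the entries whose
   index lies in mask_index m are ever read. *)
Definition mask_index (m : nat) : seq int :=
  [seq 2 * l | l <- zrange (- (2 * m%:Z)) (2 * m%:Z + 1)].

(* Every index i is 2 * p (i even) or 2 * p - 1 (i odd) for a unique p, namely
   p = floor ((i + 1) / 2). *)
Definition binary_subdiv (R : realType) (m : nat) (beta : int -> R)
    (g : zseq R) : zseq R :=
  fun i => let p := ((i + 1) %/ 2)%Z in
    if (2 %| i)%Z
    then \sum_(l <- zrange (- (2 * m%:Z)) (2 * m%:Z + 1))
           beta (2 - 2 * l) * g (p + l)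
    else \sum_(l <- zrange (- (2 * m%:Z)) (2 * m%:Z + 1))
           beta (2 * l) * g (p + l - 1).

Lemma binary_subdiv_odd (R : realType) (m : nat) (beta : int -> R)
    (g : zseq R) (p : int) :
  binary_subdiv m beta g (2 * p - 1) =
  \sum_(l <- zrange (- (2 * m%:Z)) (2 * m%:Z + 1))
    beta (2 * l) * g (p + l - 1).
Proof.
rewrite /binary_subdiv ifF; last by lia.
by have -> : ((2 * p - 1 + 1) %/ 2)%Z = p by lia.
Qed.

Lemma binary_subdiv_even (R : realType) (m : nat) (beta : int -> R)
    (g : zseq R) (p : int) :
  binary_subdiv m beta g (2 * p) =
  \sum_(l <- zrange (- (2 * m%:Z)) (2 * m%:Z + 1))
    beta (2 - 2 * l) * g (p + l).
Proof.
rewrite /binary_subdiv ifT; last by lia.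
by have -> : ((2 * p + 1) %/ 2)%Z = p by lia.
Qed.

Definition quaternary_equations (R : realType) (m : nat) (beta : int -> R)
    (f h : zseq R) : Prop :=
  forall p : int,
  [/\ h (4 * p - 2) =
        \sum_(l <- zrange (- m%:Z) m%:Z)
          \sum_(a <- zrange (- (2 * m%:Z)) (2 * m%:Z + 1))
            beta (2 - 4 * l) * beta (2 * a) * f (p + a + l - 1)
        + \sum_(l <- zrange (- m%:Z) m%:Z)
            \sum_(a <- zrange (- (2 * m%:Z)) (2 * m%:Z + 1))
              beta (- (4 * l)) * beta (2 - 2 * a) * f (p + a + l),
      h (4 * p - 1) =
        \sum_(l <- zrange (- m%:Z) m%:Z)
          \sum_(a <- zrange (- (2 * m%:Z)) (2 * m%:Z + 1))
            beta (4 * l) * beta (2 * a) * f (p + a + l - 1)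
        + \sum_(l <- zrange (- m%:Z) m%:Z)
            \sum_(a <- zrange (- (2 * m%:Z)) (2 * m%:Z + 1))
              beta (2 + 4 * l) * beta (2 - 2 * a) * f (p + a + l),
      h (4 * p) =
        \sum_(l <- zrange (- m%:Z) m%:Z)
          \sum_(a <- zrange (- (2 * m%:Z)) (2 * m%:Z + 1))
            beta (2 - 4 * l) * beta (2 - 2 * a) * f (p + a + l)
        + \sum_(l <- zrange (- m%:Z) m%:Z)
            \sum_(a <- zrange (- (2 * m%:Z)) (2 * m%:Z + 1))
              beta (- (4 * l)) * beta (2 * a) * f (p + a + l)
    & h (4 * p + 1) =
        \sum_(l <- zrange (- m%:Z) m%:Z)
          \sum_(a <- zrange (- (2 * m%:Z)) (2 * m%:Z + 1))
            beta (4 * l) * beta (2 - 2 * a) * f (p + a + l)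
        + \sum_(l <- zrange (- m%:Z) m%:Z)
            \sum_(a <- zrange (- (2 * m%:Z)) (2 * m%:Z + 1))
              beta (2 + 4 * l) * beta (2 * a) * f (p + a + l)].

(* The rule for the index 4 * p + r, r in {-2, -1, 0, 1}, has the coefficients
   c r j of the control points with offsets j in window r. *)
Definition quaternary_scheme (R : realType) (window : int -> seq int)
    (c : int -> int -> R) (S : zseq R -> zseq R) : Prop :=
  linear S /\
  forall r : int, r \in zrange (-2) 1 -> forall (g : zseq R) (p : int),
    S g (4 * p + r) = \sum_(j <- window r) c r j * g (p + j).

(* 6m + 3 offsets for r = -2, -1 and 6m + 2 offsets for r = 0, 1. *)
Definition relaxed_window (m : nat) (r : int) : seq int :=
  if r < 0 then zrange (- (3 * m%:Z) - 1) (3 * m%:Z + 1)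
  else zrange (- (3 * m%:Z)) (3 * m%:Z + 1).

Definition relaxed_quaternary_scheme (R : realType) (m : nat)
    (c : int -> int -> R) (S : zseq R -> zseq R) : Prop :=
  quaternary_scheme (relaxed_window m) c S.

(* The quadratic form in the mask whose monomials are listed, as pairs of mask
   indices, by s. *)
Definition mask_products (R : realType) (beta : int -> R)
    (s : seq (int * int)) : R :=
  \sum_(q <- s) beta q.1 * beta q.2.

(* Main.v *)
Require Import Defs.
From mathcomp Require Import all_boot all_order all_algebra.
From mathcomp Require Import functions reals.
From mathcomp Require Import boolp zify ring.

Import Order.TTheory GRing.Theory Num.Theory.
Local Open Scope ring_scope.

(** A rule of the twice applied binary scheme is a single sum over
    [-2m, 2m + 1], each of whose terms refines [f] once more.  The summation
    index [k] selects an odd rule or an even rule of that inner refinement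
    according to its parity, so the substitution [k = 2 l] or [k = 2 l + 1],
    with [l] in [-m, m] in both cases, yields the two double sums of each
    quaternary equation ([big_zrange_parity]).

    Moreover, the right-hand side of each quaternary equation is a finite sum
    of terms [beta q1 * beta q2 * f (p + j)], listed by [quaternary_terms]
    ([quaternary_equationsP]).  Collecting the terms with the same offset [j]
    ([sum_collect]) gives the coefficient of the control point [p + j], a sum of
    products of two mask entries.  As [l] and [a] run through [-m, m] and
    [-2m, 2m + 1], the offset [a + l] takes exactly the values from [-3m] to
    [3m + 1], and [a + l - 1] those from [-3m - 1] to [3m]; so the relaxed
    windows are reached exactly.  Finally, any map given by such rules is linear
    because every integer is [4 * p + r] with [-2 <= r <= 1]. *)

Lemma big_zrange_parity (V : nmodType) (m : nat) (F : int -> V) :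
  \sum_(k <- zrange (- (2 * m%:Z)) (2 * m%:Z + 1)) F k =
  \sum_(l <- zrange (- m%:Z) m%:Z) F (2 * l)
  + \sum_(l <- zrange (- m%:Z) m%:Z) F (2 * l + 1).
Proof.
move: (zrange (- m%:Z) m%:Z) (zrange_uniq (- m%:Z) m%:Z)
  (mem_zrange (- m%:Z) m%:Z) => s us mem_s.
have eqs : perm_eq (zrange (- (2 * m%:Z)) (2 * m%:Z + 1))
    ([seq 2 * l | l <- s] ++ [seq 2 * l + 1 | l <- s]).
  apply: uniq_perm; first exact: zrange_uniq.
    rewrite cat_uniq !map_inj_uniq ?us /=; try by move=> x y; lia.
    rewrite andbT; apply/hasPn => _ /mapP[l _ ->]; apply/mapP => -[l' _]; lia.
  move=> k; rewrite mem_zrange mem_cat; apply/idP/orP.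
    move=> kP; have [ev|od] : (exists l, k = 2 * l) \/ (exists l, k = 2 * l + 1).
    - have : k = 2 * (k %/ 2)%Z \/ k = 2 * (k %/ 2)%Z + 1 by lia.
      by case=> ?; [left|right]; exists (k %/ 2)%Z.
    - by case: ev => l kl; left; apply/mapP; exists l; rewrite ?mem_s//; lia.
    - by case: od => l kl; right; apply/mapP; exists l; rewrite ?mem_s//; lia.
  by case=> /mapP[l]; rewrite mem_s => ? ->; lia.
by rewrite (perm_big _ eqs) big_cat !big_map.
Qed.

Lemma binary_subdiv_twice (R : realType) (m : nat) (beta : int -> R)
    (f : zseq R) :
  quaternary_equations m beta f (binary_subdiv m beta (binary_subdiv m beta f)).
Proof.
move=> p; set g := binary_subdiv m beta f.
have godd l : g (2 * (p + l) - 1) =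
    \sum_(a <- zrange (- (2 * m%:Z)) (2 * m%:Z + 1))
      beta (2 * a) * f (p + a + l - 1).
  by rewrite /g binary_subdiv_odd; apply: eq_bigr => a _; congr (_ * f _); lia.
have godd1 l : g (2 * (p + l) + 1) =
    \sum_(a <- zrange (- (2 * m%:Z)) (2 * m%:Z + 1))
      beta (2 * a) * f (p + a + l).
  have -> : 2 * (p + l) + 1 = 2 * (p + l + 1) - 1 by lia.
  by rewrite /g binary_subdiv_odd; apply: eq_bigr => a _; congr (_ * f _); lia.
have gev l : g (2 * (p + l)) =
    \sum_(a <- zrange (- (2 * m%:Z)) (2 * m%:Z + 1))
      beta (2 - 2 * a) * f (p + a + l).
  by rewrite /g binary_subdiv_even; apply: eq_bigr => a _; congr (_ * f _); lia.
split.
- have -> : 4 * p - 2 = 2 * (2 * p - 1) by lia.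
  rewrite binary_subdiv_even big_zrange_parity; congr (_ + _);
    apply: eq_bigr => l _; under [RHS]eq_bigr do rewrite -mulrA;
    rewrite -mulr_sumr -?godd -?gev; congr (beta _ * g _); lia.
- have -> : 4 * p - 1 = 2 * (2 * p) - 1 by lia.
  rewrite binary_subdiv_odd big_zrange_parity; congr (_ + _);
    apply: eq_bigr => l _; under [RHS]eq_bigr do rewrite -mulrA;
    rewrite -mulr_sumr -?godd -?gev; congr (beta _ * g _); lia.
- have -> : 4 * p = 2 * (2 * p) by lia.
  rewrite binary_subdiv_even big_zrange_parity; congr (_ + _);
    apply: eq_bigr => l _; under [RHS]eq_bigr do rewrite -mulrA;
    rewrite -mulr_sumr -?godd1 -?gev; congr (beta _ * g _); lia.
- have -> : 4 * p + 1 = 2 * (2 * p + 1) - 1 by lia.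
  rewrite binary_subdiv_odd big_zrange_parity; congr (_ + _);
    apply: eq_bigr => l _; under [RHS]eq_bigr do rewrite -mulrA;
    rewrite -mulr_sumr -?godd1 -?gev; congr (beta _ * g _); lia.
Qed.

(** The terms [beta q1 * beta q2 * f (p + j)] of the quaternary equation for the
    index [4 * p + r], listed as triples [(j, (q1, q2))].  The two
    lists come from the two double sums.  The parity of [r] determines the first
    mask index; the sign of [r] determines the second one and the offset. *)
Definition quaternary_terms (m : nat) (r : int) : seq (int * (int * int)) :=
  [seq (if r < 0 then a + l - 1 else a + l,
        (if (2 %| r)%Z then 2 - 4 * l else 4 * l,
         if r < 0 then 2 * a else 2 - 2 * a))
    | l <- zrange (- m%:Z) m%:Z, a <- zrange (- (2 * m%:Z)) (2 * m%:Z + 1)] ++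
  [seq (a + l,
        (if (2 %| r)%Z then - (4 * l) else 2 + 4 * l,
         if r < 0 then 2 - 2 * a else 2 * a))
    | l <- zrange (- m%:Z) m%:Z, a <- zrange (- (2 * m%:Z)) (2 * m%:Z + 1)].

Lemma quaternary_equationsP (R : realType) (m : nat) (beta : int -> R)
    (f h : zseq R) :
  quaternary_equations m beta f h ->
  forall r p : int, r \in zrange (-2) 1 ->
    h (4 * p + r) = \sum_(t <- quaternary_terms m r)
                      beta t.2.1 * beta t.2.2 * f (p + t.1).
Proof.
move=> eqh r p; have [e1 e2 e3 e4] := eqh p.
rewrite mem_zrange => rP; rewrite big_cat !big_allpairs_dep /=.
have [->|[->|[->|->]]] : r = -2 \/ r = -1 \/ r = 0 \/ r = 1 by lia.
- rewrite e1; congr (_ + _); apply: eq_bigr => l _; apply: eq_bigr => a _ /=;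
    by congr (_ * f _); lia.
- rewrite e2; congr (_ + _); apply: eq_bigr => l _; apply: eq_bigr => a _ /=;
    by congr (_ * f _); lia.
- rewrite addr0 e3; congr (_ + _); apply: eq_bigr => l _;
    apply: eq_bigr => a _ /=; by congr (_ * f _); lia.
- rewrite e4; congr (_ + _); apply: eq_bigr => l _; apply: eq_bigr => a _ /=;
    by congr (_ * f _); lia.
Qed.

Lemma mem_quaternary_terms (m : nat) (r : int) (t : int * (int * int)) :
  t \in quaternary_terms m r ->
  [/\ t.1 \in relaxed_window m r, t.2.1 \in mask_index m
    & t.2.2 \in mask_index m].
Proof.
have maskP i k : i = 2 * k -> - (2 * m%:Z) <= k <= 2 * m%:Z + 1 ->
    i \in mask_index m.
  by move=> -> kP; apply/mapP; exists k => //; rewrite mem_zrange.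
rewrite /relaxed_window mem_cat => /orP[] /allpairsP[[l a]] /=;
  rewrite !mem_zrange => -[lP aP ->] /=; split.
- by case: ifP => _; rewrite mem_zrange; lia.
- by case: ifP => _; [apply: (maskP _ (1 - 2 * l))|apply: (maskP _ (2 * l))]; lia.
- by case: ifP => _; [apply: (maskP _ a)|apply: (maskP _ (1 - a))]; lia.
- by case: ifP => _; rewrite mem_zrange; lia.
- by case: ifP => _;
    [apply: (maskP _ (- (2 * l)))|apply: (maskP _ (1 + 2 * l))]; lia.
- by case: ifP => _; [apply: (maskP _ (1 - a))|apply: (maskP _ a)]; lia.
Qed.

(** Every offset of the relaxed window is attained. *)
Lemma relaxed_window_terms (m : nat) (r j : int) :
  j \in relaxed_window m r -> exists q, (j, q) \in quaternary_terms m r.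
Proof.
move=> jP.
have split_offset i : - (3 * m%:Z) <= i <= 3 * m%:Z + 1 ->
    exists l a, [/\ l \in zrange (- m%:Z) m%:Z,
      a \in zrange (- (2 * m%:Z)) (2 * m%:Z + 1) & i = a + l].
  (* l is i clamped to [-m, m], and a the remainder *)
  move=> iP; exists (Num.max (- m%:Z) (Num.min m%:Z i)).
  exists (i - Num.max (- m%:Z) (Num.min m%:Z i)); rewrite !mem_zrange.
  by split; lia.
have [jlo|jlo] : j = - (3 * m%:Z) - 1 \/ - (3 * m%:Z) <= j <= 3 * m%:Z + 1.
- by move: jP; rewrite /relaxed_window; case: ifP => _; rewrite mem_zrange; lia.
- (* this offset occurs only for negative r, in the first double sum *)
  have r0 : r < 0.
    move: jP; rewrite /relaxed_window; case: ifP => // _.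
    by rewrite mem_zrange; lia.
  have [|l [a [lP aP ja]]] := split_offset (j + 1); first lia.
  exists (if (2 %| r)%Z then 2 - 4 * l else 4 * l, 2 * a).
  rewrite mem_cat; apply/orP; left; apply/allpairsP; exists (l, a).
  by rewrite r0; split=> //=; congr (_, _); lia.
- have [l [a [lP aP ja]]] := split_offset _ jlo.
  exists (if (2 %| r)%Z then - (4 * l) else 2 + 4 * l,
          if r < 0 then 2 - 2 * a else 2 * a).
  rewrite mem_cat; apply/orP; right; apply/allpairsP; exists (l, a).
  by split=> //=; rewrite ja.
Qed.

Lemma sum_collect (R : realType) (beta : int -> R) (W : seq int)
    (T : seq (int * (int * int))) (F : int -> R) :
  uniq W -> {in T, forall t, t.1 \in W} ->
  \sum_(t <- T) beta t.2.1 * beta t.2.2 * F t.1 =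
  \sum_(j <- W) mask_products beta [seq t.2 | t <- T & t.1 == j] * F j.
Proof.
move=> uW TW.
under [RHS]eq_bigr do rewrite /mask_products big_map big_filter mulr_suml.
rewrite (exchange_big_dep xpredT)//=; apply: eq_big_seq => t tT.
under eq_bigl do rewrite eq_sym.
by rewrite -big_filter filter_pred1_uniq ?TW// big_seq1.
Qed.

Lemma stencil_linear (R : realType) (window : int -> seq int)
    (c : int -> int -> R) (S : zseq R -> zseq R) :
  (forall r : int, r \in zrange (-2) 1 -> forall (g : zseq R) (p : int),
    S g (4 * p + r) = \sum_(j <- window r) c r j * g (p + j)) ->
  linear S.
Proof.
move=> rules a u v; apply/funext => i.
have [p [r [rP ->]]] :
    exists p r : int, r \in zrange (-2) 1 /\ i = 4 * p + r.
  exists ((i + 2) %/ 4)%Z, (i - 4 * ((i + 2) %/ 4)%Z).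
  by rewrite mem_zrange; split; lia.
have -> : (a *: S u + S v) (4 * p + r) =
    a * S u (4 * p + r) + S v (4 * p + r) by [].
rewrite !rules// mulr_sumr -big_split /=; apply: eq_bigr => j _.
by have -> : (a *: u + v) (p + j) = a * u (p + j) + v (p + j) by []; ring.
Qed.

Theorem theorem2p5 (R : realType) (m : nat) :
  (forall (beta : int -> R) (f : zseq R),
     quaternary_equations m beta f
       (binary_subdiv m beta (binary_subdiv m beta f)))
  /\
  exists P : int -> int -> seq (int * int),
    (forall r j : int, r \in zrange (-2) 1 -> j \in relaxed_window m r ->
       P r j <> [::] /\
       forall q : int * int, q \in P r j ->
         q.1 \in mask_index m /\ q.2 \in mask_index m)
    /\
    forall (beta : int -> R) (S : zseq R -> zseq R),
      (forall f : zseq R, quaternary_equations m beta f (S f)) ->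
      relaxed_quaternary_scheme m (fun r j => mask_products beta (P r j)) S.
Proof.
split; first exact: binary_subdiv_twice.
exists (fun r j => [seq t.2 | t <- quaternary_terms m r & t.1 == j]); split.
  move=> r j rP /relaxed_window_terms[q qP]; split=> [P0|q'].
    suff : q \in [seq t.2 | t <- quaternary_terms m r & t.1 == j] by rewrite P0.
    by apply/mapP; exists (j, q); rewrite // mem_filter eqxx.
  case/mapP => t; rewrite mem_filter => /andP[_ /mem_quaternary_terms[_ ? ?]] ->.
  by [].
move=> beta S eqS.
have rules r : r \in zrange (-2) 1 -> forall (g : zseq R) (p : int),
    S g (4 * p + r) = \sum_(j <- relaxed_window m r)
      mask_products beta [seq t.2 | t <- quaternary_terms m r & t.1 == j]
        * g (p + j).
  move=> rP g p; rewrite (quaternary_equationsP _ _ _ _ _ (eqS g) r p rP).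
  apply: (sum_collect _ _ _ _ (fun j => g (p + j))).
    by rewrite /relaxed_window; case: ifP => _; exact: zrange_uniq.
  by move=> t /mem_quaternary_terms[].
by split; [exact: stencil_linear rules|exact: rules].
Qed.
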